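(* Assume the continuum hypothesis. Then there is an ideal $I\subset LF\setminus SF(\omega)_{IF}$ (an ideal of the lattice $LF$ containing no element of $SF(\omega)_{IF}$) such that for every $(\mathbf{\Sigma}^1_1\cup\mathbf{\Pi}^1_1)$-coloring $\delta: LF\to 2$ there is $G\in I$ such that $\delta$ is constant on the set of all groups $G'\in LF$ with $G\le G'$ and $G'\notin SF(\omega)_{IF}$.
   Context: $SF(\omega)$ is the group of all finitary (finite support) permutations of $\omega$; $LF$ is the lattice of all subgroups of $SF(\omega)$ ordered by inclusion (meet is intersection, join is the generated subgroup). $SF(\omega)_{IF}=\{G\le SF(\omega): SF(\omega)\text{ is generated by } G\cup X\text{ for some finite }X\subset SF(\omega)\}$. Topology on $LF$: for a finite set $A\subset\omega$ and a finite group $H\le SF(\omega)$ all of whose elements have support contained in $A$, let $[H,A]$ be the set of all $G\in LF$ such that the group induced by $G$ on $A$ equals $H$ (viewed as a permutation group on $A$); here the group induced by $G$ on $A$ is $\{g\in G: supp(g)\subset A\}$. The sets $[H,A]$ form a base of the topology. It is metrizable and complete: with $A_0,A_1,\dots$ an enumeration of all finite subsets of $\omega$, a metric is $d(G_1,G_2)=\sum\{2^{-n}:\text{the groups induced by }G_1\text{ and }G_2\text{ on }A_n\text{ are different}\}$. A function $\delta: LF\to 2=\{0,1\}$ is a $(\mathbf{\Sigma}^1_1\cup\mathbf{\Pi}^1_1)$-coloring if for each $i<2$ the set $\delta^{-1}(i)$ is analytic or coanalytic in $LF$. *)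

(* Defs.v *)
From HB Require Import structures.
From mathcomp Require Import all_boot all_order.
From mathcomp Require Import mathcomp_extra boolp classical_sets functions.
From mathcomp Require Import cardinality topology.

Set Implicit Arguments.
Unset Strict Implicit.
Unset Printing Implicit Defensive.

Local Open Scope classical_set_scope.

Definition supp (f : nat -> nat) : set nat := [set n | f n <> n].

Record SF := MkSF {
  sf_fun :> nat -> nat;
  _ : `[< bijective sf_fun /\ finite_set (supp sf_fun) >] }.

HB.instance Definition _ := [isSub for sf_fun].
HB.instance Definition _ := [Choice of SF by <:].

Lemma sf_ext (g h : SF) : g =1 h -> g = h.
Proof. by move=> gh; apply/val_inj/funext. Qed.

Lemma sf_bij (g : SF) : bijective g.
Proof. by case: g => f /= /asboolP[]. Qed.

Lemma sf_finite_supp (g : SF) : finite_set (supp g).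
Proof. by case: g => f /= /asboolP[]. Qed.

Fact sf_one_subproof : `[< bijective (@id nat) /\ finite_set (supp id) >].
Proof.
apply/asboolP; split; first by exists id.
by rewrite (_ : supp id = set0) // -subset0 => n.
Qed.

Definition sf_one : SF := MkSF sf_one_subproof.

Lemma supp_comp (f h : nat -> nat) (A : set nat) :
  supp f `<=` A -> supp h `<=` A -> supp (f \o h) `<=` A.
Proof.
move=> fA hA n fhn; have [hn|/hA//] := pselect (h n = n).
by apply: fA; move: fhn; rewrite /supp /= hn.
Qed.

Fact sf_mul_subproof (g h : SF) :
  `[< bijective (g \o h) /\ finite_set (supp (g \o h)) >].
Proof.
apply/asboolP; split; first exact: bij_comp (sf_bij g) (sf_bij h).
apply: (@sub_finite_set _ _ (supp g `|` supp h)).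
  by apply: supp_comp => n; [left|right].
by rewrite finite_setU; split; apply: sf_finite_supp.
Qed.

Definition sf_mul (g h : SF) : SF := MkSF (sf_mul_subproof g h).

Lemma sf_inv_ex (g : SF) : exists f, cancel g f /\ cancel f g.
Proof. by case: (sf_bij g) => f; exists f. Qed.

Definition sf_inv_fun (g : SF) : nat -> nat := projT1 (cid (sf_inv_ex g)).

Lemma sf_invK (g : SF) : cancel g (sf_inv_fun g).
Proof. by rewrite /sf_inv_fun; case: cid => f []. Qed.

Lemma sf_invVK (g : SF) : cancel (sf_inv_fun g) g.
Proof. by rewrite /sf_inv_fun; case: cid => f []. Qed.

Lemma supp_inv (g : SF) : supp (sf_inv_fun g) `<=` supp g.
Proof. by move=> n + gn; apply; rewrite -[in LHS]gn sf_invK. Qed.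

Fact sf_inv_subproof (g : SF) :
  `[< bijective (sf_inv_fun g) /\ finite_set (supp (sf_inv_fun g)) >].
Proof.
apply/asboolP; split.
  by exists g; [apply: sf_invVK|apply: sf_invK].
exact: sub_finite_set (@supp_inv g) (sf_finite_supp g).
Qed.

Definition sf_inv (g : SF) : SF := MkSF (sf_inv_subproof g).

Fact sf_mulA : associative sf_mul.
Proof. by move=> f g h; apply: sf_ext. Qed.

Fact sf_mul1 : left_id sf_one sf_mul.
Proof. by move=> f; apply: sf_ext. Qed.

Fact sf_mulr1 : right_id sf_one sf_mul.
Proof. by move=> f; apply: sf_ext. Qed.

Fact sf_mulV : left_inverse sf_one sf_inv sf_mul.
Proof. by move=> f; apply: sf_ext => n /=; rewrite sf_invK. Qed.

Fact sf_mulrV : right_inverse sf_one sf_inv sf_mul.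
Proof. by move=> f; apply: sf_ext => n /=; rewrite sf_invVK. Qed.

HB.instance Definition _ :=
  isGroup.Build SF sf_mulA sf_mul1 sf_mulr1 sf_mulV sf_mulrV.

Section Subgroups.
Context {gT : groupType}.
Implicit Types A : set gT.
Local Open Scope group_scope.

Definition is_subgroup A : Prop := group_closed [in A].

Lemma is_subgroupP A :
  is_subgroup A <->
  [/\ A 1, forall x y, A x -> A y -> A (x * y) & forall x, A x -> A x^-1].
Proof.
have memA x : (x \in [in A]) = (x \in A) by [].
split=> [cA|[A1 AM AV]].
  split=> [|x y Ax Ay|x Ax]; apply: set_mem; rewrite -memA.
  - exact: cA.1.
  - by apply: (group_closedM cA); rewrite memA; apply: mem_set.
  - by apply: (group_closedV cA); rewrite memA; apply: mem_set.
split=> [|x y]; rewrite !memA; first exact: mem_set.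
by move=> /set_mem Ax /set_mem Ay; apply: mem_set; apply/AM/AV.
Qed.

Record subgroup := Subgroup {
  subgroup_set :> set gT;
  _ : `[< is_subgroup subgroup_set >] }.

HB.instance Definition _ := [isSub for subgroup_set].
HB.instance Definition _ := [Choice of subgroup by <:].

Lemma subgroupP (G : subgroup) : is_subgroup G.
Proof. by case: G => A /= /asboolP. Qed.

Lemma subgroup_ext (G H : subgroup) : (G : set gT) = H -> G = H.
Proof. exact: val_inj. Qed.

Definition mk_subgroup A (sA : is_subgroup A) : subgroup :=
  Subgroup (asboolT sA).

Fact subgroup1_subproof : is_subgroup [set 1].
Proof.
apply/is_subgroupP; split=> [//|x y /= -> ->|x /= ->]; first by rewrite mulg1.
by rewrite invg1.
Qed.

HB.instance Definition _ :=
  isPointed.Build subgroup (mk_subgroup subgroup1_subproof).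

Definition generated A : set gT := smallest is_subgroup A.

Lemma is_subgroup_generated A : is_subgroup (generated A).
Proof.
apply/is_subgroupP; split=> [|x y Gx Gy|x Gx] H HA.
  by have [/is_subgroupP[]] := HA.
  by have [/is_subgroupP[_ HM _] _] := HA; apply: HM; [apply: Gx|apply: Gy].
by have [/is_subgroupP[_ _ HV] _] := HA; apply: HV; apply: Gx.
Qed.

Lemma is_subgroupI A B : is_subgroup A -> is_subgroup B ->
  is_subgroup (A `&` B).
Proof.
move=> /is_subgroupP[A1 AM AV] /is_subgroupP[B1 BM BV].
apply/is_subgroupP; split=> [//|x y [? ?] [? ?]|x [? ?]].
  by split; [apply: AM|apply: BM].
by split; [apply: AV|apply: BV].
Qed.

Definition subgroup_le (G H : subgroup) : bool := `[< G `<=` H >].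

Definition subgroup_meet (G H : subgroup) : subgroup :=
  mk_subgroup (is_subgroupI (subgroupP G) (subgroupP H)).

Definition subgroup_join (G H : subgroup) : subgroup :=
  mk_subgroup (is_subgroup_generated (G `|` H)).

Fact subgroup_le_refl : reflexive subgroup_le.
Proof. by move=> G; apply/asboolP. Qed.

Fact subgroup_le_anti : antisymmetric subgroup_le.
Proof.
move=> G H /andP[/asboolP GH /asboolP HG].
by apply: subgroup_ext; apply/seteqP.
Qed.

Fact subgroup_le_trans : transitive subgroup_le.
Proof.
by move=> G H K /asboolP GH /asboolP HK; apply/asboolP; apply: subset_trans HK.
Qed.

Fact subgroup_display : Order.disp_t. Proof. exact: Order.Disp tt tt. Qed.

HB.instance Definition _ := Order.Le_isPOrder.Build subgroup_display subgroup
  subgroup_le_refl subgroup_le_anti subgroup_le_trans.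

Fact subgroup_meetP (G H K : subgroup) :
  (G <= subgroup_meet H K)%O = (G <= H)%O && (G <= K)%O.
Proof.
apply/asboolP/andP => [|[/asboolP GH /asboolP GK]]; last by rewrite /= subsetI.
by rewrite /= subsetI => -[? ?]; split; apply/asboolP.
Qed.

Fact subgroup_joinP (G H K : subgroup) :
  (subgroup_join G H <= K)%O = (G <= K)%O && (H <= K)%O.
Proof.
apply/asboolP/andP => [|[/asboolP GK /asboolP HK]].
  by move=> GHK; split; apply/asboolP => x Gx; apply: GHK;
    apply: sub_gen_smallest; [left|right].
apply: smallest_sub; first exact: subgroupP.
by rewrite subUset.
Qed.

HB.instance Definition _ := Order.POrder_MeetJoin_isLattice.Build
  subgroup_display subgroup subgroup_meetP subgroup_joinP.

Lemma le_subgroupP (G H : subgroup) : reflect (G `<=` H) (G <= H)%O.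
Proof. exact: asboolP. Qed.

End Subgroups.

Arguments subgroup : clear implicits.

Definition lattice_ideal {d : Order.disp_t} {L : latticeType d} (I : set L) :
    Prop :=
  [/\ I !=set0,
      forall x y, (x <= y)%O -> I y -> I x &
      forall x y, I x -> I y -> I (Order.join x y)].

Definition LF : Type := subgroup SF.
HB.instance Definition _ := Order.Lattice.on LF.
HB.instance Definition _ := Pointed.on LF.

Definition SF_IF : set LF :=
  [set G | exists2 X : set SF, finite_set X & generated (G `|` X) = setT].

Lemma is_subgroup_supp (A : set nat) :
  is_subgroup [set g : SF | supp g `<=` A].
Proof.
apply/is_subgroupP; split=> /= [n //|g h|g gA]; first exact: supp_comp.
exact: subset_trans (@supp_inv g) gA.
Qed.

(** The elements of [G] supported in [A]; not the restrictions to [A] of the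
    elements of [G] that stabilize [A] setwise. *)
Definition induced (G : LF) (A : set nat) : LF :=
  mk_subgroup (is_subgroupI (subgroupP G) (is_subgroup_supp A)).

Definition LF_base_index : set (LF * set nat) :=
  [set HA : LF * set nat |
    [/\ finite_set HA.2, finite_set HA.1 &
        HA.1 `<=` [set h : SF | supp h `<=` HA.2]]].

Definition LF_base (HA : LF * set nat) : set LF :=
  [set G | induced G HA.2 = HA.1].

Lemma finite_set_supp (A : set nat) : finite_set A ->
  finite_set [set g : SF | supp g `<=` A].
Proof.
move=> finA; have [n An] : exists n, A `<=` `I_n.
  have /finite_seqP[m Am] := finA.
  exists (\max_(i <- m) i).+1 => k; rewrite Am /= => km.
  by rewrite ltnS; apply: (@leq_bigmax_seq _ m xpredT id).
have fixn (g : SF) i : supp g `<=` A -> n <= i -> g i = i.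
  move=> gA ni; apply: contrapT => gi; have /An/= := gA _ gi.
  by rewrite ltnNge ni.
have ltn_sf (g : SF) i : supp g `<=` A -> i < n -> g i < n.
  move=> gA ltin; rewrite [_ < _]ltnNge; apply/negP => ngi.
  have /(bij_inj (sf_bij g)) gi := fixn g _ gA ngi.
  by move: ngi; rewrite gi leqNgt ltin.
pose r (g : SF) : {ffun 'I_n -> 'I_n.+1} := [ffun i : 'I_n => inord (g i)].
have rinj : {in [set g : SF | supp g `<=` A] &, injective r}.
  move=> g h /set_mem gA /set_mem hA /ffunP rgh; apply: sf_ext => i.
  have [ltin|leni] := ltnP i n; last by rewrite !fixn.
  have := congr1 val (rgh (Ordinal ltin)); rewrite !ffunE /=.
  by rewrite !inordK // ltnS ltnW // ltn_sf.
rewrite -(eq_finite_set (inj_card_eq rinj)).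
exact: finite_finset.
Qed.

Fact LF_base_cover : \bigcup_(HA in LF_base_index) LF_base HA = setT.
Proof.
rewrite -subTset => G _; exists (induced G set0, set0) => //.
split=> /=; [exact: finite_set0| |by move=> h []].
by apply: sub_finite_set (finite_set_supp (@finite_set0 nat)) => g [].
Qed.

Fact LF_base_join (HA KB : LF * set nat) (G : LF) :
  LF_base_index HA -> LF_base_index KB -> LF_base HA G -> LF_base KB G ->
  exists LC, [/\ LF_base_index LC, LF_base LC G &
    LF_base LC `<=` LF_base HA `&` LF_base KB].
Proof.
case: HA KB => [H A] [K B] [/= fA _ _] [/= fB _ _].
rewrite /LF_base /= => GH GK.
have fAB : finite_set (A `|` B) by rewrite finite_setU.
exists (induced G (A `|` B), A `|` B); split=> //.
  split=> /=; [exact: fAB| |by move=> h []].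
  by apply: sub_finite_set (finite_set_supp fAB) => g [].
have sub (C : set nat) (G' : LF) : C `<=` A `|` B ->
    induced G' (A `|` B) = induced G (A `|` B) -> induced G' C = induced G C.
  move=> CAB /(congr1 (fun J : LF => J : set SF)) /= eG.
  have eg (g : SF) : supp g `<=` C -> (G' : set SF) g = (G : set SF) g.
    move=> gC; have := congr1 (@^~ g) eG; rewrite /setI /=.
    have -> : (supp g `<=` A `|` B) = True.
      by apply/propext; split=> // _; apply: subset_trans gC CAB.
    by rewrite !propeqE; tauto.
  apply: subgroup_ext; apply/seteqP; split=> g [Gg gC]; split=> //.
    by rewrite -(eg g gC).
  by rewrite (eg g gC).
by move=> G' /= eG; split; [rewrite -GH|rewrite -GK];
  apply: sub eG => n ?; [left|right].
Qed.

HB.instance Definition _ :=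
  isBaseTopological.Build LF LF_base_cover LF_base_join.

(** The standard definition when [T] is Polish, as [LF] is; the domain of [f]
    is the Baire space, [nat] being discrete. *)
Definition analytic {T : topologicalType} (A : set T) : Prop :=
  A = set0 \/
  exists2 f : prod_topology (fun _ : nat => nat) -> T,
    continuous f & range f = A.

Definition coanalytic {T : topologicalType} (A : set T) : Prop :=
  analytic (~` A).

Definition Sigma11_Pi11_coloring (delta : LF -> 'I_2) : Prop :=
  forall i : 'I_2,
    analytic (delta @^-1` [set i]) \/ coanalytic (delta @^-1` [set i]).

(** Reals are represented by subsets of [nat]; [countable] includes finite. *)
Definition continuum_hypothesis : Prop :=
  forall A : set (set nat), countable A \/ (A #= [set: set nat])%card.

(* Main.v *)
Require Import Defs.
From mathcomp Require Import all_boot all_order.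
From mathcomp Require Import mathcomp_extra boolp classical_sets functions.
From mathcomp Require Import cardinality topology wochoice.
From mathcomp Require Import zify.

(** For a set [L] of levels let [W_L] be the group of finitary permutations
    that preserve, for every [n] in [L], the partition of [nat] into the dyadic
    blocks [{i | i %/ 2 ^ n = u}].  If [L] is infinite, [W_L] is not in [SF_IF],
    since finitely many permutations are supported in a single block of some
    level of [L].  Conversely a group [G] containing [W_L] is determined by the
    set [P] of levels it preserves: [G = W_P] if [P] is infinite, and if [P] is
    finite then adding one transposition to [G] gives everything.  So the groups
    above [W_L] outside [SF_IF] are exactly the [W_M] with [M] an infinite
    subset of [L], and a coloring of [LF] becomes a coloring of infinite sets
    of integers.  Each color class is analytic or coanalytic, hence Ramsey by
    Silver's theorem.  Under the continuum hypothesis there is a tower of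
    infinite sets, decreasing modulo finite sets, containing a homogeneous set
    for each analytic set; the ideal is generated by the groups [W_L], for [L]
    a tail of a member of the tower. *)

Set Implicit Arguments.
Unset Strict Implicit.
Unset Printing Implicit Defensive.

Import Order.LTheory.

Local Open Scope classical_set_scope.

(** * The Ramsey property of analytic sets *)

Definition unbounded (M : set nat) : Prop := forall n, exists2 m, n <= m & M m.

Definition tail (M : set nat) n : set nat := M `&` [set k | n <= k].

Lemma sub_tail M n : tail M n `<=` M.
Proof. by move=> k []. Qed.

Lemma tailS M N n : M `<=` N -> tail M n `<=` tail N n.
Proof. by move=> MN k [/MN]. Qed.

Lemma unbounded_tail M n : unbounded M -> unbounded (tail M n).
Proof.
move=> uM k; have [m km Mm] := uM (maxn k n).
by exists m; [lia|split=> //=; lia].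
Qed.

(** These are the basic sets of the Ellentuck topology. Where the points of [M] have to lie beyond
    the stem [a], a [tail] of [M] is taken. *)
Definition ball (a M : set nat) : set (set nat) :=
  [set L | [/\ unbounded L, a `<=` L & L `<=` a `|` M]].

Lemma ballS a M N : M `<=` N -> ball a M `<=` ball a N.
Proof.
by move=> MN L [uL aL LaM]; split=> // k /LaM [ak|/MN]; [left|right].
Qed.

Lemma ball_initial a M L n : a `<=` `I_n -> ball a M L ->
  ball (L `&` `I_n) (tail M n) L.
Proof.
move=> an [uL aL LaM]; split=> // k Lk.
have [kn|nk] := ltnP k n; first by left.
by case: (LaM k Lk) => [/an/=|Mk]; [lia|right].
Qed.

Lemma ball_tail_initial a M L n : a `<=` `I_n -> ball a (tail M n) L ->
  L `&` `I_n = a.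
Proof.
move=> an [uL aL LaM]; apply/seteqP; split=> k.
  by move=> [/LaM[//|[_ /=]]] /=; lia.
by move=> ak; split; [apply: aL|apply: an].
Qed.

(** * Fusion of countably many density requirements *)

Section Fusion.
Variables (P : nat -> set nat -> set nat -> Prop) (M : set nat).
Hypothesis PS : forall j a A B, B `<=` A -> P j a A -> P j a B.
Hypothesis Pdense : forall j a m A, a `<=` `I_m -> unbounded A -> A `<=` M ->
  exists B, [/\ unbounded B, B `<=` A & P j a B].

(** A subset of the first [n.+1] integers omits or contains [n], so the induction hypothesis is used
    twice, the second time with [n] moved into the stem. *)
Lemma dense_subsets j n a m A : a `<=` `I_m -> unbounded A -> A `<=` M ->
  exists B, [/\ unbounded B, B `<=` A &
    forall b, b `<=` `I_n -> P j (b `|` a) B].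
Proof.
elim: n a m A => [|n IHn] a m A am uA AM.
  have [B [uB BA PB]] := Pdense j am uA AM.
  exists B; split=> // b b0; suff -> : b `|` a = a by [].
  by apply/setUidPr => k /b0.
have [B [uB BA PB]] := IHn a m A am uA AM.
have nam : n |` a `<=` `I_(maxn m n.+1).
  by move=> k [->/=|/am/=]; lia.
have [C [uC CB PC]] := IHn _ _ B nam uB (subset_trans BA AM).
exists C; split=> //; first exact: subset_trans CB BA.
move=> b bn; have [nb|nb] := pselect (b n); last first.
  apply: PS CB _; apply: PB => k bk; have := bn _ bk; rewrite /= ltnS leq_eqVlt.
  by case/orP=> // /eqP kn; move: bk; rewrite kn.
suff -> : b `|` a = (b `&` `I_n) `|` (n |` a) by apply: PC => k [].
apply/seteqP; split=> k.
  move=> [bk|ak]; last by right; right.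
  have := bn _ bk; rewrite /= ltnS leq_eqVlt.
  by case/orP=> [/eqP ->|kn]; [right; left|left].
by move=> [[bk _]|[->|ak]]; [left|left|right].
Qed.

Lemma dense_stems n A : unbounded A -> A `<=` M ->
  exists B, [/\ unbounded B, B `<=` A &
    forall j a, j <= n -> a `<=` `I_n -> P j a B].
Proof.
move=> uA AM; suff [B [uB BA PB]] : exists B, [/\ unbounded B, B `<=` A &
    forall j a, j < n.+1 -> a `<=` `I_n -> P j a B] by exists B.
elim: n.+1 => [|k [B [uB BA PB]]]; first by exists A; split=> // j a; rewrite ltn0.
have [C [uC CB PC]] := dense_subsets k n (@sub0set _ `I_0) uB (subset_trans BA AM).
exists C; split=> //; first exact: subset_trans CB BA.
move=> j a; rewrite ltnS leq_eqVlt => /orP[/eqP -> /PC|jk an].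
  by rewrite setU0.
exact: PS CB (PB _ _ jk an).
Qed.

(** Each stage picks a point [x] of the current set beyond the current bound, then thins the set to
    meet the requirements of index at most [x.+1] at all stems below [x.+1]. The picked points form
    [N], and past any stage [N] stays inside the set of that stage. *)
Lemma fusion n0 : unbounded M ->
  exists N, [/\ unbounded N, N `<=` M &
    forall m, m = n0 \/ (exists2 k, N k & m = k.+1) ->
    forall j a, j <= m -> a `<=` `I_m -> P j a (tail N m)].
Proof.
move=> uM.
pose good (p : nat * set nat) := [/\ unbounded p.2, p.2 `<=` M &
  forall j a, j <= p.1 -> a `<=` `I_p.1 -> P j a p.2].
pose next (p q : nat * set nat) :=
  q.2 `<=` p.2 /\ exists x, [/\ p.2 x, p.1 <= x & q.1 = x.+1].
have [A [uA AM PA]] := dense_stems n0 uM (@subset_refl _ M).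
have /choice[f Hf] : forall p, exists q, good p -> good q /\ next p q.
  move=> p; have [[up pM Pp]|] := pselect (good p); last by exists p.
  have [x px p2x] := up p.1.
  have [B [uB Bp PB]] := dense_stems x.+1 up pM.
  exists (x.+1, B) => _; split.
    by split=> //=; apply: subset_trans Bp pM.
  by split=> //; exists x.
pose s k := iter k f (n0, A).
have sS k : s k.+1 = f (s k) by [].
have good_s k : good (s k).
  by elim: k => [|k IHk]; [|rewrite sS; have [] := Hf _ IHk].
have next_s k : next (s k) (s k.+1) by rewrite sS; have [] := Hf _ (good_s k).
have s1S k : (s k).1 < (s k.+1).1.
  by have [_ [x [_ ? ->]]] := next_s k.
have s1_homo i k : i <= k -> (s i).1 <= (s k).1.
  elim: k => [|k IHk]; first by rewrite leqn0 => /eqP->.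
  rewrite leq_eqVlt => /orP[/eqP-> //|/IHk]; have := s1S k; lia.
have s1_ge k : k <= (s k).1 by elim: k => // k; have := s1S k; lia.
have s2_homo i k : i <= k -> (s k).2 `<=` (s i).2.
  elim: k => [|k IHk]; first by rewrite leqn0 => /eqP->.
  rewrite leq_eqVlt => /orP[/eqP-> //|/IHk]; have [+ _] := next_s k.
  exact: subset_trans.
pose N := [set x | exists k, [/\ (s k).2 x, (s k).1 <= x & (s k.+1).1 = x.+1]].
have tailN k : tail N (s k).1 `<=` (s k).2.
  move=> x [[i [six sx sSi]] /= kx]; apply: (@s2_homo _ i) => //.
  by rewrite leqNgt; apply/negP => /s1_homo; lia.
have NM : N `<=` M by move=> x [k [skx _ _]]; have [_ sM _] := good_s k; apply: sM.
exists N; split=> // [n|m + j a jm am].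
  have [_ [x [sx xn xS]]] := next_s n; exists x; last by exists n.
  by apply: leq_trans xn.
case=> [em|[x [k [_ _ sk]] em]].
  move: jm am; have -> : m = (s 0).1 by [].
  move=> jm am; apply: PS (@tailN 0) _; have [_ _] := good_s 0; exact.
move: jm am; rewrite em -sk => jm am.
by apply: PS (@tailN _) _; have [_ _] := good_s k.+1; apply.
Qed.

End Fusion.

(** The relation [R] presents an open set through initial segments. Stems are accepted or rejected
    as in the Galvin-Prikry theorem: either some set accepts [a], or on some set rejection passes
    from a stem to its one-point extensions. *)
Lemma open_ramsey (R : nat -> set nat -> Prop) (a M : set nat) n0 :
  a `<=` `I_n0 -> unbounded M ->
  exists N, [/\ unbounded N, N `<=` M &
    (forall L, ball a N L -> exists m, R m (L `&` `I_m)) \/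
    (forall L, ball a N L -> forall m, ~ R m (L `&` `I_m))].
Proof.
move=> a0 uM; pose O L := exists m, R m (L `&` `I_m).
pose accept b A := forall L, ball b A L -> O L.
pose P1 (j : nat) b A :=
  accept b A \/ forall B, unbounded B -> B `<=` A -> ~ accept b B.
have P1S j b A B : B `<=` A -> P1 j b A -> P1 j b B.
  move=> BA [acc|rej]; [left|right].
    by move=> L /(ballS BA)/acc.
  by move=> C uC CB; apply: rej => //; apply: subset_trans CB BA.
have P1d j b m A : b `<=` `I_m -> unbounded A -> A `<=` M ->
    exists B, [/\ unbounded B, B `<=` A & P1 j b B].
  move=> _ uA AM; have [[B [uB BA aB]]|rej] :=
    pselect (exists B, [/\ unbounded B, B `<=` A & accept b B]).
    by exists B; split=> //; left.
  by exists A; split=> //; right => B uB BA aB; apply: rej; exists B.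
have [M1 [uM1 M1M dec]] := fusion P1S P1d n0 uM.
have acceptS b A B : B `<=` A -> accept b A -> accept b B.
  by move=> BA acc L /(ballS BA)/acc.
have [[B [uB BM1 aB]]|rej0] :=
    pselect (exists B, [/\ unbounded B, B `<=` M1 & accept a B]).
  by exists B; split=> //; [apply: subset_trans BM1 M1M|left].
pose reject b := forall B, unbounded B -> B `<=` M1 -> ~ accept b B.
have rej : reject a by move=> B uB BM1 aB; apply: rej0; exists B.
have decided b m : m = n0 \/ (exists2 k, M1 k & m = k.+1) -> b `<=` `I_m ->
    ~ reject b -> accept b (tail M1 m).
  move=> mM bm nrej; case: (dec _ mM 0 b (leq0n _) bm) => // rejb.
  case: nrej => B uB BM1 aB; apply: (rejb (tail B m)).
  - exact: unbounded_tail.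
  - exact: tailS.
  - exact: acceptS (@sub_tail _ _) aB.
have [N [uN NM1 rejN]] : exists N, [/\ unbounded N, N `<=` M1 &
    forall b m, m = n0 \/ (exists2 k, N k & m = k.+1) -> b `<=` `I_m ->
    reject b -> forall n, tail N m n -> reject (n |` b)].
  pose P (j : nat) (b A : set nat) :=
    reject b -> forall n, A n -> reject (n |` b).
  have PS j b A B : B `<=` A -> P j b A -> P j b B.
    by move=> BA PA rb n /BA; apply: PA.
  have Pd j b m1 A : b `<=` `I_m1 -> unbounded A -> A `<=` M1 ->
      exists B, [/\ unbounded B, B `<=` A & P j b B].
    move=> bm uA AM1; have [rb|nrb] := pselect (reject b); last first.
      by exists A; split=> // /nrb.
    (* Each extension of [b] by a point of [Q] is accepted by a tail of [M1]. A member of [ball b Q]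
       lies in such an accepting ball, through its least element from [m1] on. So an unbounded [Q]
       would accept [b]. *)
    pose Q := [set n | [/\ A n, m1 <= n & ~ reject (n |` b)]].
    have [uQ|nuQ] := pselect (unbounded Q).
      exfalso; apply: (rb Q uQ); first by move=> n [/AM1].
      move=> L [uL bL LQ].
      have exL : exists n, `[< L n >] && (m1 <= n).
        by have [n mn Ln] := uL m1; exists n; rewrite mn andbT; apply/asboolP.
      case: (ex_minnP exL) => n /andP[/asboolP Ln mn] nmin.
      have Qn : Q n by case: (LQ _ Ln) => // /bm/=; lia.
      case: Qn => An _ nr; apply: (decided (n |` b) n.+1) => //.
      - by right; exists n => //; apply: AM1.
      - by move=> k [->/=//|/bm/=]; lia.
      split=> // [k [->//|/bL//]|k Lk].
      case: (LQ _ Lk) => [bk|[Ak mk _]]; first by left; right.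
      have /(_ _)/wrap[] := nmin k; first by rewrite mk andbT; apply/asboolP.
      rewrite leq_eqVlt => /orP[/eqP<-|nk]; first by left; left.
      by right; split=> //; apply: AM1.
    have /existsNP[n1 Qn1] := nuQ.
    exists (tail A (maxn n1 m1)); split=> [||_ n [An /= nn]].
    - exact: unbounded_tail.
    - exact: sub_tail.
    apply: contrapT => nr; apply: Qn1; exists n; first lia.
    by split=> //; lia.
  have [N [uN NM PN]] := fusion PS Pd n0 uM1.
  by exists N; split=> // b m mN bm; apply: (PN m mN m b).
exists (tail N n0); split.
- exact: unbounded_tail.
- by move=> k [/NM1/M1M].
right=> L bL m RL.
have [uL aL LaN] := bL.
have LN k : n0 <= k -> L k -> tail N n0 k.
  by move=> n0k /LaN[/a0 /=|//]; lia.
have La : L `&` `I_n0 = a by apply: ball_tail_initial bL.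
have ltS k : L `&` `I_k.+1 = if pselect (L k) then k |` (L `&` `I_k)
                             else L `&` `I_k.
  case: pselect => Lk; apply/seteqP; split=> i.
  - move=> [Li /= ik]; have [->|ik'] := eqVneq i k; first by left.
    by right; split=> //=; lia.
  - by move=> [->|[Li /= ik]]; split=> //=; lia.
  - move=> [Li /= ik]; split=> //=; have : i <> k by move=> ik'; subst.
    lia.
  - by move=> [Li /= ik]; split=> //=; lia.
(* Rejection is passed on only at bounds that are [n0] or just past a point of [N]; [m'] is such a
   bound at which [L] already has its trace below [n]. *)
have stage n : n0 <= n -> exists m', [/\ m' = n0 \/ (exists2 k, N k & m' = k.+1),
    m' <= n & L `&` `I_n = L `&` `I_m'].
  elim: n => [|n IHn] n0n.
    by exists n0; split; [left|lia|]; have -> : n0 = 0 by lia.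
  have [n0E|n0n1] := eqVneq n0 n.+1.
    by exists n0; split; [left|lia|rewrite n0E].
  have [Ln|nLn] := pselect (L n).
    have [|Nn _] := LN n _ Ln; first lia.
    by exists n.+1; split=> //; right; exists n.
  have [|m' [mN mn LE]] := IHn; first lia.
  by exists m'; split=> //; [lia|rewrite ltS; case: pselect].
have {}rejN n : n0 <= n -> reject (L `&` `I_n).
  elim: n => [|n IHn] n0n.
    have <- : n0 = 0 by lia.
    by rewrite La.
  have [n0E|n0n1] := eqVneq n0 n.+1; first by rewrite -n0E La.
  have {}IHn : reject (L `&` `I_n) by apply: IHn; lia.
  rewrite ltS; case: pselect => // Ln.
  have [|m' [mN mn LE]] := stage n; first lia.
  have [|Nn _] := LN n _ Ln; first lia.
  by apply: (rejN _ m') => //; rewrite LE => k [].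
(* Every set with the trace of [L] below [m1] satisfies [R] at [m] as [L] does, so a tail of [M1]
   accepts a stem that is rejected. *)
have [m1 [m1N mm1]] : exists m1, (exists2 k, M1 k & m1 = k.+1) /\ maxn m n0 <= m1.
  by have [k mk Mk] := uM1 (maxn m n0); exists k.+1; split; [exists k|lia].
apply: (rejN m1 _ _ (unbounded_tail m1 uM1) (@sub_tail _ _)); first lia.
move=> L' bL'; exists m; suff -> : L' `&` `I_m = L `&` `I_m by [].
have : L' `&` `I_m1 = L `&` `I_m1 by apply: ball_tail_initial bL' => k [].
move=> E; have IE K : K `&` `I_m = (K `&` `I_m1) `&` `I_m.
  by apply/seteqP; split=> k; [move=> [? /= ?]; split=> //; split=> //=; lia|
    move=> [[]]].
by rewrite IE E -IE.
Qed.

(** * Tree projections and Silver's theorem *)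

Definition restr (L : set nat) n : seq bool := mkseq (fun i => `[< L i >]) n.

Lemma restr_eq L L' n : restr L n = restr L' n <-> L `&` `I_n = L' `&` `I_n.
Proof.
split=> [LL'|LL'].
  have E k : k < n -> L k = L' k.
    move=> kn; have := congr1 (nth false ^~ k) LL'.
    rewrite /restr !nth_mkseq // => H; by apply/propext; apply: asbool_eq_equiv.
  by apply/seteqP; split=> k [Lk /= kn]; split=> //; [rewrite -E|rewrite E].
apply/eq_in_map => k; rewrite mem_iota => /andP[_ kn]; apply: asbool_equiv_eq.
by split=> Lk; [have : (L `&` `I_n) k by []; rewrite LL' => -[]|
  have : (L' `&` `I_n) k by []; rewrite -LL' => -[]].
Qed.

(** The normal form of analytic sets of sets of integers: the projection of a closed set of pairs,
    given by finite approximations. *)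
Definition tree_proj (T : set (seq nat * seq bool)) : set (set nat) :=
  [set L | exists f : nat -> nat, forall n, T (mkseq f n, restr L n)].

(** The sets [A s] split the projection according to the first values [s] of the witness. A first
    fusion decides, for each stem and each [s] of small code, whether [A s] is avoided below the
    stem or met below every further set. *)
Theorem silver T M : unbounded M ->
  exists N, [/\ unbounded N, N `<=` M &
    (forall L, unbounded L -> L `<=` N -> tree_proj T L) \/
    (forall L, unbounded L -> L `<=` N -> ~ tree_proj T L)].
Proof.
move=> uM; pose code (s : seq nat) : nat := pickle s.
have codeI : injective code by apply: pcan_inj pickleK.
pose A s := [set L | exists f : nat -> nat, mkseq f (size s) = s /\
  forall n, T (mkseq f n, restr L n)].
have tree_projE : tree_proj T = A [::].
  by apply/seteqP; split=> L [f]; [move=> Hf; exists f|move=> [_ Hf]; exists f].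
have AS s L : A s L -> exists k, A (rcons s k) L.
  move=> [f [fs Hf]]; exists (f (size s)), f; split=> //.
  by rewrite size_rcons mkseqS fs.
have AT s L : A s L -> T (s, restr L (size s)).
  by move=> [f [fs Hf]]; rewrite -{1}fs.
pose D j a B := forall s : seq nat, code s = j ->
  (forall L, ball a B L -> ~ A s L) \/
  (forall C, unbounded C -> C `<=` B -> exists2 L, ball a C L & A s L).
have DS j a B C : C `<=` B -> D j a B -> D j a C.
  move=> CB DB s sj; have [nA|yA] := DB s sj; [left|right].
    by move=> L /(ballS CB)/nA.
  by move=> E uE EC; apply: yA => //; apply: subset_trans EC CB.
have Dd j a m B : a `<=` `I_m -> unbounded B -> B `<=` M ->
    exists C, [/\ unbounded C, C `<=` B & D j a C].
  move=> _ uB _.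
  have [[s [sj [C [uC CB nA]]]]|nC] := pselect (exists s : seq nat, code s = j /\
    exists C, [/\ unbounded C, C `<=` B & forall L, ball a C L -> ~ A s L]).
    exists C; split=> // s' s'j; left.
    suff <- : s = s' by [].
    by apply: codeI; rewrite sj.
  exists B; split=> // s sj; right=> C uC CB; apply: contrapT => nL.
  by apply: nC; exists s; split=> //; exists C; split=> // L ? ?; apply: nL; exists L.
have [M1 [uM1 M1M dec]] := fusion DS Dd 0 uM.
pose good s a := forall C, unbounded C -> C `<=` M1 ->
  exists2 L, ball a C L & A s L.
have decided s a k : M1 k -> code s <= k.+1 -> a `<=` `I_k.+1 ->
    (forall L, ball a (tail M1 k.+1) L -> ~ A s L) \/ good s a.
  move=> Mk sk ak; have kM : k.+1 = 0 \/ exists2 k', M1 k' & k.+1 = k'.+1.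
    by right; exists k.
  have [nA|yA] := dec _ kM _ _ sk ak _ erefl; [by left|right=> C uC CM1].
  have [|L bL AL] := yA _ (unbounded_tail k.+1 uC); first exact: tailS.
  by exists L => //; apply: ballS bL; apply: sub_tail.
(* That [m] is just past a point of [c] and bounds the code of [rcons s k] lets the next fusion
   treat this pair at [m]. The bound on [size s] keeps the trace long enough to determine the node
   of [T]. *)
pose R (s : seq nat) m (c : set nat) := exists x (k : nat),
  [/\ c x /\ m = x.+1, code (rcons s k) <= m, size s < m & good (rcons s k) c].
have goodR s a n B : a `<=` `I_n -> unbounded B -> B `<=` M1 -> good s a ->
    exists C, [/\ unbounded C, C `<=` B &
      forall L, ball a C L -> exists m, R s m (L `&` `I_m)].
  move=> an uB BM1 gs.
  (* The negative case is absurd: a member of [A s] in the ball lies in some [A (rcons s k)], so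
     just past a late point this pair is not avoided and, being decided, is good. *)
  have [C [uC CB [yR|nR]]] := open_ramsey (R s) an uB; first by exists C.
  have [|L bL /AS[k AL]] := gs _ uC; first exact: subset_trans CB BM1.
  have [uL aL LaC] := bL.
  have [x xm Lx] := uL (n + code (rcons s k) + size s).
  have Mx : M1 x by case: (LaC _ Lx) => [/an/=|/CB/BM1//]; lia.
  have Lx1 : L `&` `I_x.+1 `<=` `I_x.+1 by move=> ? [].
  exfalso; apply: (nR L bL x.+1); exists x, k; split=> //.
  - by split=> //; split=> //=.
  - lia.
  - lia.
  have [|nA|//] := decided (rcons s k) _ x Mx _ Lx1; first lia.
  exfalso; apply: (nA L) => //; apply: ball_initial (ballS (subset_trans CB BM1) bL).
  by move=> i /an /=; lia.
(* If [good [::] set0] fails, then [A [::]] is avoided below some set.  Otherwise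
   open sets being Ramsey yields, for each good pair [(s, a)], a set below which
   some extension of [s] is good at a longer initial segment; fusing these sets,
   every [L] in the result carries a branch of good pairs, all in [T]. *)
have [gs|] := pselect (good [::] set0); last first.
  move=> /existsNP[C] /not_implyP[uC] /not_implyP[CM1 nL].
  exists C; split=> //; first exact: subset_trans CM1 M1M.
  right=> L uL LC; rewrite tree_projE => AL; apply: nL; exists L => //.
  by split=> // k /LC; right.
pose P j a B := forall s : seq nat, code s = j -> good s a ->
  forall L, ball a B L -> exists m, R s m (L `&` `I_m).
have PS j a B C : C `<=` B -> P j a B -> P j a C.
  by move=> CB PB s sj gsa L /(ballS CB); apply: PB.
have Pd j a m B : a `<=` `I_m -> unbounded B -> B `<=` M1 ->
    exists C, [/\ unbounded C, C `<=` B & P j a C].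
  move=> am uB BM1.
  have [[s [sj gsa]]|nC] := pselect (exists s : seq nat, code s = j /\ good s a).
    have [C [uC CB RC]] := goodR s a m B am uB BM1 gsa.
    exists C; split=> // s' s'j _.
    suff <- : s = s' by [].
    by apply: codeI; rewrite sj.
  by exists B; split=> // s sj gsa; case: nC; exists s.
have [N0 [uN0 N0M1 PN0]] := fusion PS Pd 0 uM1.
have [N [uN NN0 RN]] := goodR [::] set0 0 N0 (@sub0set _ _) uN0 N0M1 gs.
exists N; split=> //.
  by apply: subset_trans NN0 _; apply: subset_trans N0M1 M1M.
left=> L uL LN.
(* The invariant along the branch: [s] is good at a trace of [L], and a good extension of it is
   available at a later trace. *)
pose st s := exists2 m, size s <= m & good s (L `&` `I_m) /\
  exists m', R s m' (L `&` `I_m').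
have stS s : st s -> exists k, st (rcons s k).
  move=> [m sm [gsm [m' [x [k [[Lx m'E] pm szm gk]]]]]]; exists k, m'.
    by rewrite size_rcons.
  split=> //; apply: (PN0 m' _ _ (L `&` `I_m') pm _ (rcons s k) erefl gk).
  - by right; exists x => //; apply: NN0; apply: LN; case: Lx.
  - by move=> ? [].
  apply: (@ball_initial set0); first exact: sub0set.
  by split=> // i /LN/NN0; right.
have st0 : st [::].
  exists 0 => //; split; last by apply: RN; split=> // i /LN; right.
  by have -> : L `&` `I_0 = set0 by apply/seteqP; split=> i [].
have /choice[g gP] : forall s, exists k, st s -> st (rcons s k).
  by move=> s; have [/stS[k]|] := pselect (st s); [exists k|exists 0].
pose t n := iter n (fun s => rcons s (g s)) [::].
have stt n : st (t n) by elim: n => // n /gP.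
pose f n := g (t n).
have tE n : t n = mkseq f n by elim: n => // n IHn; rewrite mkseqS -IHn.
exists f => n; have [m sm [gtm _]] := stt n.
(* Goodness yields a member of [A (t n)] that agrees with [L] below [m], hence below [n]; this puts
   the node in [T]. *)
have [L' bL' /AT] := gtm _ (unbounded_tail m uM1) (@sub_tail _ _).
have -> : size (t n) = n by rewrite tE size_mkseq.
rewrite tE; suff -> : restr L' n = restr L n by [].
have {bL'}LL' : L' `&` `I_m = L `&` `I_m.
  by apply: ball_tail_initial bL' => i [].
have nm : n <= m by move: sm; rewrite tE size_mkseq.
have IE K : K `&` `I_n = (K `&` `I_m) `&` `I_n.
  by rewrite -setIA; congr (_ `&` _); apply/esym/setIidPr => i /= ?; lia.
by apply/restr_eq; rewrite IE LL' -IE.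
Qed.

(** * Towers under the continuum hypothesis *)

Definition almost_sub (L M : set nat) : Prop := exists n, tail L n `<=` M.

Lemma almost_sub_trans L M N :
  almost_sub L M -> almost_sub M N -> almost_sub L N.
Proof.
move=> [m LM] [n MN]; exists (maxn m n) => k [Lk /= km].
by apply: MN; split=> /=; [apply: LM; split=> //=; lia|lia].
Qed.

Lemma tail_tail M m n : tail (tail M m) n = tail M (maxn m n).
Proof.
apply/seteqP; split=> k; first by move=> [[Mk /= mk] /= nk]; split=> //=; lia.
by move=> [Mk /= mnk]; split=> //=; [split=> //=|]; lia.
Qed.

Section PseudoIntersection.
Variables (X : Type) (D : set X) (F : X -> set nat).
Hypothesis uF : forall x, D x -> unbounded (F x).
Hypothesis chainF : forall x y, D x -> D y ->
  almost_sub (F x) (F y) \/ almost_sub (F y) (F x).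

(** The induction keeps [M] equal to [setT] or to a tail of one of the sets. Of that set and the
    next one, the smaller modulo finite sets has a tail in both. *)
Lemma finite_intersection (f : X -> nat) n : {in D &, injective f} ->
  exists2 M, unbounded M & forall x, D x -> f x < n -> M `<=` F x.
Proof.
move=> injf.
suff [M [MF MT]] : exists M, (forall x, D x -> f x < n -> M `<=` F x) /\
    (M = setT \/ exists2 x, D x & exists k, M = tail (F x) k).
  exists M => //; case: MT => [->|[x Dx [k ->]]]; first by move=> k; exists k.
  by apply: unbounded_tail; apply: uF.
elim: n => [|n [M [MF MT]]]; first by exists setT; split=> //; left.
have [[x0 [Dx0 fx0]]|nx0] := pselect (exists x, D x /\ f x = n); last first.
  exists M; split=> // x Dx; rewrite ltnS leq_eqVlt => /orP[/eqP fx|]; last exact: MF.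
  by case: nx0; exists x.
have stepP N : N `<=` M -> N `<=` F x0 -> forall x, D x -> f x < n.+1 -> N `<=` F x.
  move=> NM Nx0 x Dx; rewrite ltnS leq_eqVlt => /orP[/eqP fx|/(MF x Dx)]; last first.
    exact: subset_trans.
  by have -> : x = x0 by apply: injf; rewrite ?inE // fx fx0.
case: MT => [MT|[z Dz [k Mk]]].
  exists (tail (F x0) 0); split; last by right; exists x0 => //; exists 0.
  by apply: stepP; [rewrite MT|apply: sub_tail].
have [[j zx]|[j xz]] := chainF Dz Dx0.
  exists (tail (F z) (maxn k j)); split; last by right; exists z => //; exists (maxn k j).
  apply: stepP; first by rewrite Mk -tail_tail; apply: sub_tail.
  by rewrite maxnC -tail_tail; apply: subset_trans (@sub_tail _ _) zx.
exists (tail (F x0) (maxn k j)); split; last by right; exists x0 => //; exists (maxn k j).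
apply: stepP; last exact: sub_tail.
rewrite Mk maxnC -tail_tail; exact: tailS.
Qed.

Lemma pseudo_intersection : countable D ->
  exists2 L, unbounded L & forall x, D x -> almost_sub L (F x).
Proof.
move=> /countable_injP[f injf].
have /choice[g gP] n : exists k, n <= k /\ forall x, D x -> f x < n -> F x k.
  have [M uM MF] := finite_intersection n injf.
  by have [k nk Mk] := uM n; exists k; split=> // x Dx fx; apply: MF Mk.
exists (range g) => [n|x Dx]; first by exists (g n); [have [] := gP n|exists n].
(* Only the values [g n] with [n <= f x] can miss [F x]. *)
exists (\max_(i < (f x).+1) g i).+1 => _ [[n _ <-] /= gn].
have [_] := gP n; apply=> //; rewrite ltnNge; apply/negP => nx.
have nx1 : n < (f x).+1 by [].
by have := @leq_bigmax _ (fun i : 'I_(f x).+1 => g i) (Ordinal nx1); rewrite /=; lia.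
Qed.

End PseudoIntersection.

(** If some initial segment of a well-order is uncountable, the least such segment is by hypothesis
    in bijection with all sets of integers, and its order is transported. *)
Lemma continuum_hypothesis_order : continuum_hypothesis ->
  exists lt : set nat -> set nat -> Prop,
    [/\ well_founded lt,
        forall x y, [\/ lt x y, x = y | lt y x] &
        forall x, countable [set y | lt y x]].
Proof.
move=> CH; have [R woR] := well_ordering_principle (set nat).
have woRT : wo_chain R predT by apply: withinW woR.
have Rtot : total R by move=> x y; apply: (wo_chainW woRT).
have Ranti : antisymmetric R by move=> x y; apply: (wo_chain_antisymmetric woRT).
pose lt x y := R x y /\ x <> y.
have lt_min (A : set (set nat)) x : A x -> exists2 y, A y & forall z, A z -> ~ lt z y.
  move=> Ax; have [|y [[Ay ymin] _]] := woR (fun z => z \in A); first by exists x; apply: mem_set.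
  exists y; first exact: set_mem.
  move=> z Az [zy nzy]; apply: nzy; apply: Ranti; rewrite zy /=.
  by apply: ymin; apply: mem_set.
have lt_wf : well_founded lt.
  move=> x; apply: contrapT => nx.
  have [y ny ymin] := lt_min [set x | ~ Acc lt x] x nx.
  by apply: ny; split=> z zy; apply: contrapT => /ymin.
have [g injg cg] : exists2 g : set nat -> set nat, injective g &
    forall x, countable [set y | lt y (g x)].
  have [|/existsNP[x0 nx0]] := pselect (forall x, countable [set y | lt y x]).
    by exists id.
  have [x ncx xmin] := lt_min [set x | ~ countable [set y | lt y x]] x0 nx0.
  have [//|] := CH [set y | lt y x].
  rewrite card_eq_sym => /card_set_bijP[g [gx injg _]]; exists g.
    by move=> y z; apply: injg; rewrite inE.
  by move=> y; apply: contrapT => /xmin; apply; apply: gx.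
exists (fun x y => lt (g x) (g y)); split.
- move=> x; elim/(well_founded_ind lt_wf): {x}(g x) {-2}x (erefl (g x)) => a IHa x gx.
  by split=> y; rewrite gx => /IHa; apply.
- move=> x y; have [gxy|gxy] := eqVneq (g x) (g y).
    by constructor 2; apply: injg.
  by have /orP[] := Rtot (g x) (g y); [constructor 1|constructor 3]; split=> //;
    apply/eqP => //; rewrite eq_sym.
move=> x; have /countable_injP[f injf] := cg x.
apply/countable_injP; exists (f \o g) => y z; rewrite !inE /= => yx zx fyz.
by apply: injg; apply: injf fyz; rewrite inE.
Qed.

(** By transfinite recursion: the countably many sets chosen before [x] are pairwise comparable, so
    they have a pseudo-intersection, which is thinned to satisfy [H x]. *)
Lemma tower (H : set nat -> set nat -> Prop) : continuum_hypothesis ->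
  (forall x M, unbounded M -> exists N, [/\ unbounded N, N `<=` M & H x N]) ->
  exists F : set nat -> set nat,
    (forall x, unbounded (F x) /\ H x (F x)) /\
    (forall x y, almost_sub (F x) (F y) \/ almost_sub (F y) (F x)).
Proof.
move=> /continuum_hypothesis_order[lt [lt_wf lt_total lt_countable]] Hdense.
pose good x (f : forall y, lt y x -> set nat) :=
  [set N | [/\ unbounded N, H x N & forall y (yx : lt y x), almost_sub N (f y yx)]].
(* [setT] is only a default value; [Fgood] shows that a good set exists at every stage. *)
pose F := Fix lt_wf (fun _ => set nat) (fun x f => xget setT (good x f)).
have FE x : F x = xget setT (good x (fun y _ => F y)).
  rewrite /F Fix_eq // => y f g fg; congr (xget _ (good y _)).
  apply: functional_extensionality_dep => z.
  by apply: functional_extensionality_dep => zy.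
have Fgood x : good x (fun y _ => F y) (F x).
  elim/(well_founded_ind lt_wf): x => x IHx.
  rewrite [X in good _ _ X]FE; apply: xgetPex.
  have [|y z yx zx|L uL LF] := @pseudo_intersection _ [set y | lt y x] F _ _ (lt_countable x).
  - by move=> y /IHx[].
  - have [yz|->|zy] := lt_total y z; last 1 first.
    + by left; have [_ _] := IHx y yx; apply.
    + by right; have [_ _] := IHx z zx; apply.
    + by left; exists 0; apply: sub_tail.
  have [N [uN NL HN]] := Hdense x L uL.
  exists N; split=> // y yx; apply: almost_sub_trans (LF y yx).
  by exists 0 => k [/NL].
exists F; split=> [x|x y]; first by have [] := Fgood x.
have [xy|->|yx] := lt_total x y.
- by right; have [_ _] := Fgood y; apply.
- by left; exists 0; apply: sub_tail.
- by left; have [_ _] := Fgood x; apply.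
Qed.

(** * Overgroups of the level groups *)

Section SFFacts.
Local Open Scope group_scope.

Lemma sf_one_apply i : (1 : SF) i = i. Proof. by []. Qed.

Lemma sf_mul_apply (g h : SF) i : (g * h) i = g (h i). Proof. by []. Qed.

Lemma sf_VK (g : SF) i : g^-1 (g i) = i. Proof. exact: sf_invK. Qed.

Lemma sf_KV (g : SF) i : g (g^-1 i) = i. Proof. exact: sf_invVK. Qed.

Lemma sf_inj (g : SF) : injective g. Proof. exact: bij_inj (sf_bij g). Qed.

Lemma finite_set_bounded (A : set nat) : finite_set A -> exists n, A `<=` `I_n.
Proof.
move=> /finite_seqP[m ->]; exists (\max_(i <- m) i).+1 => k /= km.
by rewrite ltnS; apply: (@leq_bigmax_seq _ m xpredT id).
Qed.

Lemma sf_ex (f f' : nat -> nat) n : cancel f f' -> cancel f' f ->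
  (forall i, n <= i -> f i = i) -> exists g : SF, g =1 f.
Proof.
move=> ff' f'f fn.
suff fP : `[< bijective f /\ finite_set (supp f) >] by exists (MkSF fP).
apply/asboolP; split; first by exists f'.
apply: sub_finite_set (finite_II n) => i; rewrite /supp /= => fi.
by rewrite ltnNge; apply/negP => /fn.
Qed.

End SFFacts.

(** * Dyadic blocks and the permutations preserving them *)

Definition blk n i := i %/ 2 ^ n.

Lemma blk_le a b i : a <= b -> blk b i = blk a i %/ 2 ^ (b - a).
Proof. by move=> ab; rewrite /blk -divnMA -expnD subnKC. Qed.

Lemma blk_eqW a b i j : a <= b -> blk a i = blk a j -> blk b i = blk b j.
Proof. by move=> ab ij; rewrite !(blk_le _ ab) ij. Qed.

Lemma blk0 i : blk 0 i = i. Proof. by rewrite /blk divn1. Qed.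

Lemma blk_small n i : i < 2 ^ n -> blk n i = 0.
Proof. exact: divn_small. Qed.

Lemma blk_exp n m : m < n -> blk n (2 ^ m) = 0.
Proof. by move=> mn; apply: blk_small; rewrite ltn_exp2l. Qed.

Lemma blk_exp_ge n m : n <= m -> blk n (2 ^ m) = 2 ^ (m - n).
Proof. by move=> nm; rewrite /blk -expnB. Qed.

Definition level_preserving n (g : nat -> nat) :=
  forall i j, (blk n (g i) == blk n (g j)) = (blk n i == blk n j).

Lemma level_preserving_eq n g i j : level_preserving n g ->
  blk n i = blk n j -> blk n (g i) = blk n (g j).
Proof. by move=> ng ij; apply/eqP; rewrite ng ij. Qed.

Definition level_set (L : set nat) : set SF :=
  [set g : SF | forall n, L n -> level_preserving n g].

Lemma is_subgroup_level_set L : is_subgroup (level_set L).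
Proof.
apply/is_subgroupP; split=> [n _ i j //|g h gL hL n Ln i j|g gL n Ln i j].
  by rewrite !sf_mul_apply gL // hL.
by rewrite -(gL n Ln) !sf_KV.
Qed.

Definition level_group (L : set nat) : LF := mk_subgroup (is_subgroup_level_set L).

Lemma level_set1 L : level_set L 1%g.
Proof. by have /is_subgroupP[] := is_subgroup_level_set L. Qed.

Lemma level_setM L g h : level_set L g -> level_set L h -> level_set L (g * h)%g.
Proof. by have /is_subgroupP[_ + _] := is_subgroup_level_set L; apply. Qed.

Lemma level_setV L g : level_set L g -> level_set L g^-1%g.
Proof. by have /is_subgroupP[_ _] := is_subgroup_level_set L; apply. Qed.

Lemma level_setS (L M : set nat) : L `<=` M -> level_set M `<=` level_set L.
Proof. by move=> LM g gM n /LM/gM. Qed.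

Lemma level_preserving0 (g : SF) : level_preserving 0 g.
Proof. by move=> i j; rewrite !blk0 (inj_eq (@sf_inj g)). Qed.

Definition block_swap p u v i :=
  if blk p i == u then v * 2 ^ p + i %% 2 ^ p
  else if blk p i == v then u * 2 ^ p + i %% 2 ^ p else i.

Section BlockSwap.
Variables (p u v : nat).
Let s := block_swap p u v.

Lemma blk_add w i : blk p (w * 2 ^ p + i %% 2 ^ p) = w.
Proof.
by rewrite /blk divnMDl ?expn_gt0 // divn_small ?addn0 // ltn_mod expn_gt0.
Qed.

Lemma mod_add w i : (w * 2 ^ p + i %% 2 ^ p) %% 2 ^ p = i %% 2 ^ p.
Proof. by rewrite modnMDl modn_mod. Qed.

Lemma block_swapK : involutive s.
Proof.
move=> i; rewrite /s {2}/block_swap; case: eqP => [iu|iu].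
  rewrite /block_swap blk_add mod_add; case: eqP => [vu|_].
    by rewrite vu -iu -divn_eq.
  by rewrite eqxx -iu -divn_eq.
case: eqP => [iv|iv].
  by rewrite /block_swap blk_add mod_add eqxx -iv -divn_eq.
by rewrite /block_swap; case: eqP => // _; case: eqP.
Qed.

Lemma block_swap_out i : blk p i <> u -> blk p i <> v -> s i = i.
Proof. by rewrite /s /block_swap; do 2 case: eqP => //. Qed.

Lemma blk_block_swap i : blk p i = u -> blk p (s i) = v.
Proof. by rewrite /s /block_swap => ->; rewrite eqxx blk_add. Qed.

(** On each [p]-block the swap is a translation by a multiple of [2 ^ p], which carries [c]-blocks
    to [c]-blocks; the converse holds because [s] is an involution. *)
Lemma block_swap_below c : c <= p -> level_preserving c s.
Proof.
move=> cp; have sc i j : blk c i = blk c j -> blk c (s i) = blk c (s j).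
  move=> ij; have ijp := blk_eqW cp ij.
  have E w : blk c (w * 2 ^ p + i %% 2 ^ p) = blk c (w * 2 ^ p + j %% 2 ^ p).
    have p2 : 2 ^ p = 2 ^ (p - c) * 2 ^ c by rewrite -expnD subnK.
    rewrite p2 mulnA /blk !divnMDl ?expn_gt0 //.
    by rewrite -!modn_divl; congr (_ + _ %% _).
  rewrite /s /block_swap -ijp; case: ifP => _; first exact: E.
  by case: ifP => _; first exact: E.
move=> i j; apply/eqP/eqP => [|/sc//].
by move=> /sc; rewrite !block_swapK.
Qed.

Lemma block_swap_above c : p <= c -> u %/ 2 ^ (c - p) = v %/ 2 ^ (c - p) ->
  level_preserving c s.
Proof.
move=> pc uv; have E i : blk c (s i) = blk c i.
  rewrite !(blk_le _ pc) /s /block_swap; case: eqP => [->|_].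
    by rewrite blk_add.
  by case: eqP => [->|//]; rewrite blk_add.
by move=> i j; rewrite !E.
Qed.

Lemma block_swap_ex : exists g : SF, g =1 s.
Proof.
apply: (@sf_ex s s ((u + v).+1 * 2 ^ p) block_swapK block_swapK) => i iuv.
have : (u + v).+1 <= blk p i by rewrite leq_divRL // expn_gt0.
by move=> iuv'; apply: block_swap_out; lia.
Qed.

End BlockSwap.

(** Coarser levels are preserved because both blocks lie in one [d.+1]-block. *)
Lemma sibling_swap d x y : blk d.+1 x = blk d.+1 y ->
  exists2 g : SF, level_set setT g & g =1 block_swap d (blk d x) (blk d y).
Proof.
move=> xy; have [g gE] := block_swap_ex d (blk d x) (blk d y).
exists g => // c _ i j; rewrite !gE; have [cd|dc] := leqP c d.
  exact: block_swap_below.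
apply: block_swap_above; first exact: ltnW.
by rewrite -!blk_le ?(ltnW dc) //; apply: blk_eqW xy.
Qed.

(** If [x] and [y] lie in different halves of their block, the halves are swapped first; the
    induction then continues inside the half of [y]. *)
Lemma local_transitivity d x y : blk d x = blk d y ->
  exists g : SF, [/\ level_set setT g, g x = y &
    forall k, g k <> k -> blk d k = blk d x].
Proof.
elim: d x y => [|d IHd] x y xy.
  exists 1%g; split=> [||k /(_ erefl)//]; first exact: level_set1.
  by rewrite !blk0 in xy.
have [xyd|nxyd] := eqVneq (blk d x) (blk d y).
  have [g [Wg gx gk]] := IHd _ _ xyd; exists g; split=> // k /gk.
  exact: blk_eqW.
have [g Wg gE] := sibling_swap xy.
have [|h [Wh hx hk]] := IHd (g x) y; first by rewrite gE blk_block_swap.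
exists (h * g)%g; split=> //; first exact: level_setM.
move=> k; rewrite sf_mul_apply => hgk.
have [gk|gk] := eqVneq (g k) k.
  rewrite gk in hgk; rewrite (blk_eqW (leqnSn d) (hk _ hgk)).
  have gxy : blk d (g x) = blk d y by rewrite gE blk_block_swap.
  by rewrite xy (blk_eqW (leqnSn d) gxy).
have [kx|kx] := eqVneq (blk d k) (blk d x); first exact: blk_eqW kx.
have [ky|ky] := eqVneq (blk d k) (blk d y).
  by rewrite xy; apply: blk_eqW ky.
by move/eqP: gk; rewrite gE block_swap_out //; apply/eqP.
Qed.

Lemma blk_large x d : x <= d -> blk d x = 0.
Proof. by move=> xd; apply: blk_small; apply: leq_ltn_trans xd (ltn_expl _ _). Qed.

Lemma level_set_transitive x y : exists2 g : SF, level_set setT g & g x = y.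
Proof.
have [|g [Wg gx _]] := @local_transitivity (x + y) x y.
  by rewrite !blk_large ?leq_addl ?leq_addr.
by exists g.
Qed.

Section InvariantRelation.
Variable E : nat -> nat -> Prop.
Hypothesis Esym : forall i j, E i j -> E j i.
Hypothesis Etrans : forall i j k, E i j -> E j k -> E i k.
Hypothesis Einv : forall (g : SF) i j, level_set setT g -> E i j -> E (g i) (g j).

(** The points [i] and [j] first share a block at some level [d.+1] with [c <= d]. Moving [i] to [x]
    relates [x] to a point [j'] of the other half of that block. If [y] lies in that half too, [j']
    is moved to [y] with [x] fixed; otherwise [x] is moved to [y] with [j'] fixed, so both are
    related to [j']. *)
Lemma invariant_relation_block c i j : E i j -> blk c i <> blk c j ->
  forall x y, blk c.+1 x = blk c.+1 y -> E x y.
Proof.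
move=> Eij ijc x y xyc.
have exd : exists d, blk d i == blk d j.
  by exists (i + j); rewrite !blk_large ?leq_addl ?leq_addr.
case: (ex_minnP exd) => -[|d] /eqP ijd mind.
  by case: ijc; rewrite -[c]addn0; apply: blk_eqW ijd.
have cd : c <= d.
  rewrite leqNgt; apply/negP => dc; apply: ijc; exact: blk_eqW ijd.
have xyd : blk d.+1 x = blk d.+1 y by apply: blk_eqW xyc.
have ijd' : blk d i <> blk d j.
  by move=> /eqP/mind; rewrite ltnn.
have [w Ww wi] := level_set_transitive i x.
set j' := w j.
have Exj : E x j' by rewrite -wi; apply: Einv.
have xj : blk d.+1 x = blk d.+1 j'.
  by rewrite -wi; apply: level_preserving_eq => //; apply: Ww.
have nxj : blk d x <> blk d j'.
  by rewrite -wi => /eqP; rewrite Ww // => /eqP.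
have [/eqP yx|yx] := eqVneq (blk d y) (blk d x).
  have [h [Wh hx hk]] := local_transitivity (esym (eqP yx)).
  apply: (Etrans Exj); apply: Esym; rewrite -hx.
  have <- : h j' = j' by apply: contrapT => /hk /esym.
  exact: Einv Wh Exj.
have yj : blk d j' = blk d y.
  move: xj xyd nxj yx; rewrite ![blk d.+1 _](blk_le _ (leqnSn d)) subSnn expn1.
  lia.
have [h [Wh hj hk]] := local_transitivity yj.
rewrite -hj; have <- : h x = x by apply: contrapT => /hk.
exact: Einv Wh Exj.
Qed.

End InvariantRelation.

(** At levels above [a] every block is mapped to itself. At levels up to [a] no block meets both the
    [a]-block of [x], where [h] is [g], and its complement, where [h] is the identity. *)
Lemma sf_restrict (g : SF) a x : level_preserving a g -> blk a (g x) = blk a x ->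
  exists h : SF,
    (forall k, h k = if blk a k == blk a x then g k else k) /\
    forall c, level_preserving c g -> level_preserving c h.
Proof.
move=> ga gx.
have gk k : (blk a (g k) == blk a x) = (blk a k == blk a x) by rewrite -{1}gx ga.
have gVk k : (blk a (g^-1%g k) == blk a x) = (blk a k == blk a x).
  by rewrite -gk sf_KV.
pose f (g : nat -> nat) k := if blk a k == blk a x then g k else k.
have [n gn] := finite_set_bounded (sf_finite_supp g).
have [|||h hE] := @sf_ex (f g) (f g^-1%g) n.
- move=> k; rewrite /f; case: (boolP (blk a k == _)) => kx.
    by rewrite gk kx sf_VK.
  by rewrite (negPf kx).
- move=> k; rewrite /f; case: (boolP (blk a k == _)) => kx.
    by rewrite gVk kx sf_KV.
  by rewrite (negPf kx).
- move=> k nk; rewrite /f; case: ifP => // _; apply: contrapT => /gn /=; lia.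
exists h; split=> [k|c gc i j]; first by rewrite hE.
have [ca|ac] := leqP c a; last first.
  have E k : blk c (h k) = blk c k.
    rewrite hE /f; case: eqP => // kx; apply: blk_eqW (ltnW ac) _.
    by apply/eqP; rewrite kx gk kx.
  by rewrite !E.
have ne k l : blk a k <> blk a l -> (blk c k == blk c l) = false.
  by move=> kl; apply/negP => /eqP/(blk_eqW ca).
have gkx k : blk a k = blk a x -> blk a (g k) = blk a x.
  by move=> kx; apply/eqP; rewrite gk kx.
rewrite !hE /f.
case: (eqVneq (blk a i)) => [ix|/eqP ix]; case: (eqVneq (blk a j)) => [jx|/eqP jx] //.
- by rewrite !ne ?gkx ?ix //; apply: nesym.
- by rewrite !ne ?gkx ?jx.
Qed.

Lemma greatest_below (P : set nat) b : P 0 -> 0 < b ->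
  exists a, [/\ P a, a < b & forall c, a < c < b -> ~ P c].
Proof.
move=> P0; elim: b => // b IHb _.
have [Pb|nPb] := pselect (P b).
  by exists b; split=> // c; lia.
case: b IHb nPb => [//|b] /(_ isT)[a [Pa ab nP]] nPb; exists a; split=> //.
  lia.
move=> c ac; have [->//|cb] := eqVneq c b.+1; apply: nP; lia.
Qed.

(** * Recovering a group above [level_set setT] from its levels *)

Section Overgroups.
Variable G : LF.
Let Gs : set SF := G.
Hypothesis WG : level_set setT `<=` Gs.

Let G1 : Gs 1%g. Proof. by have /is_subgroupP[] := subgroupP G. Qed.
Let GM g h : Gs g -> Gs h -> Gs (g * h)%g.
Proof. by have /is_subgroupP[_ + _] := subgroupP G; apply. Qed.
Let GV g : Gs g -> Gs g^-1%g.
Proof. by have /is_subgroupP[_ _] := subgroupP G; apply. Qed.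

Definition levels : set nat := [set n | forall g, Gs g -> level_preserving n g].

Lemma levels0 : levels 0. Proof. by move=> g _; apply: level_preserving0. Qed.

Lemma sub_levels : Gs `<=` level_set levels.
Proof. by move=> g Gg n /(_ g Gg). Qed.

(** When [a] is a level of [G] and the two blocks differ, [s] acts on the [a]-blocks as a
    transposition and fixes all points of the other blocks. *)
Definition exchangeable a i j := exists s : SF,
  [/\ Gs s, blk a (s i) = blk a j &
    forall k, s k <> k -> blk a k = blk a i \/ blk a k = blk a j].

Section Level.
Variable a : nat.
Hypothesis Pa : levels a.
Let E := exchangeable a.

Lemma exchangeable_blk i j : blk a i = blk a j -> E i j.
Proof. by move=> ij; exists 1%g; split. Qed.

Lemma exchangeable_refl i : E i i. Proof. exact: exchangeable_blk. Qed.

Lemma exchangeable_eq i j i' j' : blk a i = blk a i' -> blk a j = blk a j' ->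
  E i j -> E i' j'.
Proof.
move=> ii jj [s [Gg sij sk]]; exists s; split=> //.
  by rewrite -jj -sij; apply: level_preserving_eq (esym ii); apply: Pa.
by move=> k /sk; rewrite ii jj.
Qed.

Lemma exchangeable_sym i j : E i j -> E j i.
Proof.
move=> [s [Gg sij sk]]; exists s^-1%g; split; first exact: GV.
  by apply/eqP; rewrite -(Pa Gg) sf_KV sij.
move=> k sVk; have [skk|ki|kj] := sk k; [|by right|by left].
by apply: sVk; rewrite -{1}skk sf_VK.
Qed.

Lemma exchangeable_inv (g : SF) i j : Gs g -> E i j -> E (g i) (g j).
Proof.
move=> Gg [s [Gss sij sk]]; exists (g * s * g^-1)%g; split.
- by apply: GM (GV Gg); apply: GM.
- by rewrite !sf_mul_apply sf_VK; apply: level_preserving_eq sij; apply: Pa.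
move=> k; rewrite !sf_mul_apply => gsk.
have : s (g^-1%g k) <> g^-1%g k by move=> skk; apply: gsk; rewrite skk sf_KV.
by move=> /sk[] kE; [left|right]; rewrite -{1}[k](sf_KV g);
  apply: level_preserving_eq kE; apply: Pa.
Qed.

(** For three distinct blocks, the exchange of the last two fixes [i], and conjugating by it turns
    [E i j] into [E i k]. *)
Lemma exchangeable_trans i j k : E i j -> E j k -> E i k.
Proof.
move=> ij jk.
have [bij|bij] := eqVneq (blk a i) (blk a j).
  exact: exchangeable_eq (esym bij) erefl jk.
have [bik|bik] := eqVneq (blk a i) (blk a k); first exact: exchangeable_blk.
have [t [Gt tjk tl]] := jk.
have ti : t i = i.
  by apply: contrapT => /tl[] /eqP; [rewrite (negPf bij)|rewrite (negPf bik)].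
have := exchangeable_inv Gt ij; rewrite ti; exact: exchangeable_eq.
Qed.

Lemma exchangeable_sibling i j : blk a.+1 i = blk a.+1 j -> E i j.
Proof.
move=> ij; have [g Wg gE] := sibling_swap ij; exists g; split=> [||k].
- exact: WG.
- by rewrite gE blk_block_swap.
rewrite gE => gk; apply: contrapT => /not_orP[ki kj]; apply: gk.
exact: block_swap_out.
Qed.

(* If the [c]-blocks lie in [E]-classes but [G] does not preserve level [c], then
   an element of [G] turns some pair of [E]-related points into one lying in
   different [c]-blocks, so that even the [c.+1]-blocks lie in [E]-classes. *)
Lemma exchangeable_next b : a < b -> (forall c, a < c < b -> ~ levels c) ->
  forall i j, blk b i = blk b j -> E i j.
Proof.
elim: b => // b IHb; rewrite ltnS leq_eqVlt => /orP[/eqP <- _|ab nP].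
  exact: exchangeable_sibling.
have {}IHb : forall i j, blk b i = blk b j -> E i j.
  by apply: IHb => // c cab; apply: nP; lia.
have /nP : a < b < b.+1 by lia.
move=> /existsNP[g /not_implyP[Gg /existsNP[i /existsNP[j]]]] gij.
have [k [l [Ekl kl]]] : exists k l, E k l /\ blk b k <> blk b l.
  case: (eqVneq (blk b i) (blk b j)) gij => [ij|/eqP ij].
    move=> /eqP; rewrite eqb_id => /eqP gij; exists (g i), (g j); split=> //.
    by apply: exchangeable_inv => //; apply: IHb.
  move=> /eqP; rewrite eqbF_neg negbK => /eqP gij; exists i, j; split=> //.
  rewrite -[i](sf_VK g) -[j](sf_VK g).
  by apply: exchangeable_inv; [apply: GV|apply: IHb].
apply: (@invariant_relation_block E _ _ _ b k l) => //.
- exact: exchangeable_sym.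
- exact: exchangeable_trans.
- by move=> h x y Wh; apply: exchangeable_inv; apply: WG.
Qed.

Definition contains_local := forall g u, level_set levels g ->
  (forall k, g k <> k -> blk a k = u) -> Gs g.

Lemma contains_exchanging g : contains_local -> level_set levels g ->
  (forall i, E i (g i)) -> Gs g.
Proof.
move=> Gloc Wg Eg; have [N gN] := finite_set_bounded (sf_finite_supp g).
suff H m K f : level_set levels f -> (forall i, E i (f i)) ->
    (forall k, blk a k < K -> f k = k) ->
    (forall k, K + m <= blk a k -> f k = k) -> Gs f.
  apply: (H N 0) => // k; rewrite add0n => Nk; apply: contrapT => /gN /=.
  by have := leq_div k (2 ^ a); rewrite -/(blk a k); lia.
(* The blocks are cleared one after the other: an exchange puts the [K]-th block
   back in its place, and a local element then makes it pointwise fixed. *)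
elim: m K f => [|m IHm] K f Wf Ef fK fKm.
  suff -> : f = 1%g by [].
  apply: sf_ext => k; rewrite sf_one_apply.
  by have [/fK|kK] := ltnP (blk a k) K => //; apply: fKm; lia.
pose x := K * 2 ^ a.
have xK : blk a x = K by rewrite /blk mulnK ?expn_gt0.
have [s [Gss sfx sk]] := exchangeable_sym (Ef x).
have Ws := sub_levels Gss.
pose f1 := (s * f)%g.
have [h [hE hlev]] : exists h : SF,
    (forall k, h k = if blk a k == blk a x then f1 k else k) /\
    forall c, level_preserving c f1 -> level_preserving c h.
  by apply: sf_restrict => //; apply: (level_setM Ws Wf).
have Wh : level_set levels h.
  by move=> c Pc; apply: hlev; apply: (level_setM Ws Wf).
have Gh : Gs h.
  apply: (Gloc h K) => // k; rewrite hE xK; case: eqP => //.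
have hx k : blk a (h k) = blk a k.
  rewrite hE; case: eqP => // kx; rewrite kx -sfx.
  by apply: level_preserving_eq kx; apply: (level_setM Ws Wf).
have Eh k : E k (h^-1%g k).
  by apply: exchangeable_blk; rewrite -{1}(sf_KV h k) hx.
(* If [s] moves [k], it also moves [s k], so both lie in the two exchanged blocks. *)
have Es k : E k (s k).
  have [->|/eqP sk1] := eqVneq (s k) k; first exact: exchangeable_refl.
  have sk2 : s (s k) <> s k by move=> /sf_inj.
  have fxx := exchangeable_sym (Ef x); have xfx := Ef x.
  have [e1|e1] := sk _ sk1; have [e2|e2] := sk _ sk2.
  - by apply: exchangeable_blk; rewrite e1.
  - exact: exchangeable_eq (esym e1) (esym e2) fxx.
  - exact: exchangeable_eq (esym e1) (esym e2) xfx.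
  - by apply: exchangeable_blk; rewrite e1.
pose f2 := (h^-1 * f1)%g.
(* A point fixed by [f] in the block of [f x] would lie in the block of [x], because [f] preserves
   level [a]; so [s] fixes [k]. *)
have f2_id k : blk a k <> K -> f k = k -> f2 k = k.
  move=> kK fk; have sfk : s k = k.
    apply: contrapT => /sk[kE|]; last by rewrite xK.
    apply: kK; rewrite -xK; apply/eqP; have Wfa := Wf _ Pa.
    by rewrite -(Wfa k x) fk kE.
  have hk : h k = k by rewrite hE xK; case: eqP.
  by rewrite /f2 /f1 !sf_mul_apply fk sfk -{1}hk sf_VK.
suff Gf2 : Gs f2.
  have -> : f = (s^-1 * (h * f2))%g.
    by apply: sf_ext => k; rewrite /f2 /f1 !sf_mul_apply sf_KV sf_VK.
  by apply: GM; [apply: GV|apply: GM].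
apply: (IHm K.+1).
- by apply: level_setM; [apply: level_setV|apply: level_setM].
- move=> i; apply: exchangeable_trans (Ef i) _.
  by apply: exchangeable_trans (Es _) _; apply: Eh.
- move=> k; rewrite ltnS leq_eqVlt => /orP[/eqP kK|kK].
    rewrite /f2 sf_mul_apply; have := hE k; rewrite xK kK eqxx => <-.
    by rewrite sf_VK.
  by apply: f2_id; [lia|apply: fK].
- by move=> k kK; apply: f2_id; [lia|apply: fKm; lia].
Qed.

End Level.

Lemma sf_fixK (g : SF) k : g k <> k -> g (g k) <> g k.
Proof. by move=> gk /sf_inj. Qed.

Lemma contains_local0 : contains_local 0.
Proof.
move=> g u _ gu; suff -> : g = 1%g by [].
apply: sf_ext => k; rewrite sf_one_apply; apply: contrapT => gk.
have := gu _ gk; rewrite -(gu _ (sf_fixK gk)) !blk0 => /esym; exact: gk.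
Qed.

(** With [a] the greatest level below [b], all [a]-blocks inside one [b]-block are exchangeable, so
    [contains_exchanging] reduces the claim from [b] to [a]. *)
Lemma contains_localP b : levels b -> contains_local b.
Proof.
elim/ltn_ind: b => b IHb Pb.
have [->|] := posnP b; first exact: contains_local0.
move=> /(greatest_below levels0)[a [Pa ab nP]] g u Wg gu.
apply: (contains_exchanging Pa (IHb a ab Pa) Wg) => i.
have [->|/eqP gi] := eqVneq (g i) i; first exact: exchangeable_refl.
apply: (exchangeable_next Pa ab nP).
by rewrite (gu _ gi) (gu _ (sf_fixK gi)).
Qed.

(** A finite support lies in the first block of some level, where [contains_localP] applies. *)
Lemma unbounded_levels : unbounded levels -> Gs = level_set levels.
Proof.
move=> uP; apply/seteqP; split; first exact: sub_levels.
move=> g Wg; have [n gn] := finite_set_bounded (sf_finite_supp g).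
have [b nb Pb] := uP n; apply: (contains_localP Pb Wg (u := 0)) => k /gn /= kn.
by apply: blk_large; lia.
Qed.

(** With no positive level to stop at, [exchangeable_next] reaches every block, so any two points
    are exchangeable at level 0. *)
Lemma only_level0 : (forall c, 0 < c -> ~ levels c) -> Gs = setT.
Proof.
move=> nP; apply/seteqP; split=> // g _.
apply: (contains_exchanging levels0 contains_local0).
  by move=> [_|c /nP//]; [apply: level_preserving0|lia].
move=> i; apply: (@exchangeable_next _ levels0 (i + g i).+1) => //.
  by move=> c /andP[/nP].
by rewrite !blk_large //; lia.
Qed.

End Overgroups.

(** * Levels and membership in [SF_IF] *)

Lemma level_breaking_swap n : exists t : SF, forall c, 0 < c <= n -> ~ level_preserving c t.
Proof.
(* This transposes 0 and [2 ^ n]. The points 0 and 1 share a [c]-block, while their images [2 ^ n]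
   and 1 do not. *)
have [t tE] := block_swap_ex 0 0 (2 ^ n).
exists t => c /andP[c0 cn] /(_ 0 1).
have n0 : 0 < n by lia.
have t1 : t 1 = 1.
  rewrite tE block_swap_out // blk0 //.
  by have := ltn_exp2l 0 n (isT : 1 < 2); rewrite n0 expn0; lia.
have t0 : t 0 = 2 ^ n.
  by rewrite tE /block_swap blk0 eqxx expn0 muln1 mod0n addn0.
rewrite t0 t1 -[1](expn0 2) blk_exp // blk_exp_ge // (@blk_large 0) // eqxx.
by rewrite expn_eq0.
Qed.

(** One permutation breaking all levels from 1 to a bound [n] leaves only level 0, and [only_level0]
    applies. *)
Lemma bounded_levels_IF (G : LF) : level_set setT `<=` (G : set SF) ->
  ~ unbounded (levels G) -> SF_IF G.
Proof.
move=> WG /existsNP[n Pn]; have [t tP] := level_breaking_swap n.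
exists [set t]; first exact: finite_set1.
pose G2 : LF := mk_subgroup (is_subgroup_generated (G `|` [set t])).
have GG2 : (G : set SF) `<=` (G2 : set SF).
  by move=> g Gg; apply: sub_gen_smallest; left.
have : (G2 : set SF) = setT.
  apply: only_level0; first exact: subset_trans WG GG2.
  move=> c c0 Pc; have [cn|nc] := leqP c n.
    apply: (tP c); first lia.
    by apply: Pc; apply: sub_gen_smallest; right.
  apply: Pn; exists c; first lia.
  by move=> g /GG2; apply: Pc.
by [].
Qed.

Lemma level_group_not_IF L : unbounded L -> ~ SF_IF (level_group L).
Proof.
move=> uL [X finX genX].
have [n Xn] : exists n, \bigcup_(g in X) supp g `<=` `I_n.
  by apply: finite_set_bounded; apply: bigcup_finite => // g _; apply: sf_finite_supp.
have [b nb Lb] := uL n.+1; have [t tP] := level_breaking_swap b.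
apply: (tP b); first lia.
suff : generated (level_set L `|` X) `<=` level_set [set b].
  by rewrite genX; apply.
apply: smallest_sub; first exact: is_subgroup_level_set.
move=> g [/(_ b Lb) gb _ ->//|Xg _ -> i j].
suff E i' : blk b (g i') = blk b i' by rewrite !E.
have [->//|/eqP gi] := eqVneq (g i') i'.
have H k : g k <> k -> k < n by move=> gk; apply: Xn; exists g.
have := H _ gi; have := H _ (sf_fixK gi) => ? ?.
by rewrite !blk_large //; lia.
Qed.

Lemma levels_level_group L c : unbounded L -> levels (level_group L) c -> 0 < c -> L c.
Proof.
move=> uL Pc c0; apply: contrapT => nLc.
have [|p [p0L pc nP]] := @greatest_below (0 |` L) c _ c0; first by left.
have exq : exists q, `[< L q >] && (c < q).
  by have [q cq Lq] := uL c.+1; exists q; rewrite cq andbT; apply/asboolP.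
case: (ex_minnP exq) => q /andP[/asboolP Lq cq] qmin.
(* Both blocks lie in the first [q]-block, and [L] has no element strictly between [p] and [q], so
   [s] is in [level_set L]. It sends 0 to [2 ^ q.-1] and fixes [2 ^ p], which shares a [c]-block
   with 0; thus level [c] is broken. *)
have [s sE] := block_swap_ex p 0 (2 ^ (q.-1 - p)).
have Ws : level_set L s.
  move=> l Ll i j; rewrite !sE; have [lp|pl] := leqP l p.
    exact: block_swap_below.
  apply: block_swap_above; first exact: ltnW.
  rewrite div0n divn_small // ltn_exp2l //.
  suff : q <= l by lia.
  have [cl|lc] := ltnP c l; first by apply: qmin; rewrite cl andbT; apply/asboolP.
  have : l <> c by move=> lc'; apply: nLc; rewrite -lc'.
  move=> lc'; exfalso; apply: (nP l); first lia.
  by right.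
have := Pc s Ws 0 (2 ^ p); rewrite !sE.
rewrite [block_swap p _ _ (2 ^ p)]block_swap_out; last 2 first.
- by rewrite blk_exp_ge // subnn.
- rewrite blk_exp_ge // subnn => /eqP; rewrite eq_sym -(expn0 2) eqn_exp2l //; lia.
have -> : block_swap p 0 (2 ^ (q.-1 - p)) 0 = 2 ^ q.-1.
  rewrite /block_swap (@blk_large 0) // eqxx mod0n addn0 -expnD subnK //.
  lia.
rewrite (blk_exp_ge (m := q.-1)); last lia.
by rewrite blk_exp // (@blk_large 0) // eqxx ; rewrite expn_eq0.
Qed.

Theorem overgroups_level_group L (G : LF) : unbounded L -> (level_group L <= G)%O ->
  ~ SF_IF G -> exists M, [/\ unbounded M, M `<=` L & G = level_group M].
Proof.
move=> uL /le_subgroupP LG nIF.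
have WG : level_set setT `<=` (G : set SF).
  by apply: subset_trans LG; apply: level_setS.
have uP : unbounded (levels G).
  by apply: contrapT => nuP; apply: nIF; apply: bounded_levels_IF.
have PL c : levels G c -> 0 < c -> L c.
  by move=> Pc; apply: levels_level_group => // g Wg; apply: Pc; apply: LG.
(* Intersecting with [L] can discard only level 0, which every permutation preserves. *)
exists (levels G `&` L); split=> //.
  move=> n; have [m nm Pm] := uP n.+1; exists m; first lia.
  by split=> //; apply: PL => //; lia.
apply: subgroup_ext; rewrite (unbounded_levels WG uP).
apply/seteqP; split; first by apply: level_setS => c [].
move=> g Wg [|c] Pc; first exact: level_preserving0.
by apply: Wg; split=> //; apply: PL.
Qed.

(** * Colorings of the lattice of subgroups *)

Lemma open_LF_base (HA : LF * set nat) : LF_base_index HA -> open (LF_base HA).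
Proof. by move=> HAi; exists [set HA]; [move=> _ ->|rewrite bigcup_set1]. Qed.

Lemma near_induced (G : LF) (A : set nat) : finite_set A ->
  nbhs G [set K : LF | induced K A = induced G A].
Proof.
move=> finA; apply: open_nbhs_nbhs; split=> //.
apply: (@open_LF_base (induced G A, A)); split=> //; last by move=> h [].
exact: sub_finite_set (@subIsetr _ _ _) (finite_set_supp finA).
Qed.

Lemma initial_segments_cvg (h : nat -> nat) (g : nat -> nat -> nat) :
  (forall n, mkseq (g n) n = mkseq h n) ->
  (g : nat -> prod_topology (fun _ : nat => nat)) @ \oo -->
    (h : prod_topology (fun _ : nat => nat)).
Proof.
move=> gh; apply/cvg_sup => i U [V [[W oW <-] Wh] VU].
exists i.+1 => // n /= ni; apply: VU => /=.
have := congr1 (nth 0 ^~ i) (gh n); rewrite /= !nth_mkseq // => ->.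
exact: Wh.
Qed.

(** A permutation supported below [n] maps every block of level at least [n] to itself, so only the
    levels below [n] matter. *)
Lemma level_group_local (L M : set nat) (g : SF) n : supp g `<=` `I_n ->
  restr L n = restr M n -> (level_group L : set SF) g -> (level_group M : set SF) g.
Proof.
move=> gn /restr_eq LM gL c Mc.
have [cn|nc] := ltnP c n.
  by apply: gL; have : (M `&` `I_n) c by []; rewrite -LM => -[].
suff E k : blk c (g k) = blk c k by move=> i j; rewrite !E.
have [->//|/eqP gk] := eqVneq (g k) k.
by have := gn _ gk; have := gn _ (sf_fixK gk) => /= ? ?; rewrite !blk_large //; lia.
Qed.

(** The nodes of [T] approximate pairs with [f h = level_group L]. Along a branch such pairs
    converge, and the equation passes to the limit one permutation at a time, by continuity of [f]
    and [level_group_local]. *)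
Lemma analytic_tree_proj (A : set LF) : analytic A ->
  exists T, forall L, tree_proj T L <-> A (level_group L).
Proof.
move=> [->|[f f_cont <-]].
  by exists set0 => L; split=> // -[h /(_ 0)].
exists [set p | exists h L, [/\ size p.1 = size p.2, mkseq h (size p.1) = p.1,
  restr L (size p.2) = p.2 & f h = level_group L]] => L; split; last first.
  by move=> [h _ fh]; exists h => n; exists h, L; rewrite /= !size_mkseq.
move=> [h hT].
have /choice[g /choice[M gM]] : forall n, exists g, exists L', [/\ mkseq g n = mkseq h n,
    restr L' n = restr L n & f g = level_group L'].
  move=> n; have [g [L' /=]] := hT n; rewrite !size_mkseq => -[_ gh LL' fg].
  by exists g, L'.
exists h => //; apply: subgroup_ext.
suff H k : (f h : set SF) k <-> (level_group L : set SF) k.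
  by apply/seteqP; split=> k /H.
have fin_k := sf_finite_supp k.
have [n kn] := finite_set_bounded fin_k.
have gh : (g : nat -> prod_topology (fun _ : nat => nat)) @ \oo -->
    (h : prod_topology (fun _ : nat => nat)).
  by apply: initial_segments_cvg => m; have [] := gM m.
have [N _ HN] := gh _ (f_cont h _ (near_induced (f h) fin_k)).
have := HN (maxn N n) (leq_maxl _ _); rewrite /= => indE.
have [_ ML fg] := gM (maxn N n).
have kNn : supp k `<=` `I_(maxn N n) by move=> i /kn /=; lia.
have -> : (f h : set SF) k <-> (f (g (maxn N n)) : set SF) k.
  have := congr1 (fun J : LF => (J : set SF) k) indE.
  rewrite /= /setI /= => E; split=> fk.
    have : (f h : set SF) k /\ supp k `<=` supp k by split.
    by rewrite -E => -[].
  have : (f (g (maxn N n)) : set SF) k /\ supp k `<=` supp k by split.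
  by rewrite E => -[].
rewrite fg; split; apply: level_group_local kNn _ => //.
Qed.

(** Pairs of finite sequences are coded by integers, so every [T] is coded by some index [x] of the
    tower. *)
Lemma ramsey_tower : continuum_hypothesis ->
  exists F : set nat -> set nat,
    [/\ forall x, unbounded (F x),
        forall x y, almost_sub (F x) (F y) \/ almost_sub (F y) (F x) &
        forall T, exists x, (forall L, unbounded L -> L `<=` F x -> tree_proj T L) \/
          (forall L, unbounded L -> L `<=` F x -> ~ tree_proj T L)].
Proof.
move=> CH; pose dec (x : set nat) : set (seq nat * seq bool) := [set p | x (pickle p)].
pose H x N := (forall L, unbounded L -> L `<=` N -> tree_proj (dec x) L) \/
  (forall L, unbounded L -> L `<=` N -> ~ tree_proj (dec x) L).
have [F [FH Fchain]] := @tower H CH (fun x M uM => silver (dec x) uM).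
exists F; split=> // [x|T]; first by have [] := FH x.
exists [set n | exists2 p, T p & pickle p = n].
have [_] := FH [set n | exists2 p, T p & pickle p = n].
rewrite /H; suff -> : dec [set n | exists2 p, T p & pickle p = n] = T by [].
apply/seteqP; split=> p; last by exists p.
by move=> [q Tq /(pcan_inj pickleK) <-].
Qed.

Lemma level_groupS L M : L `<=` M -> (level_group M <= level_group L)%O.
Proof. by move=> LM; apply/le_subgroupP; apply: level_setS. Qed.

Lemma le_SF_IF (G H : LF) : (G <= H)%O -> SF_IF G -> SF_IF H.
Proof.
move=> /le_subgroupP GH [X finX genX]; exists X => //.
rewrite -subTset -genX; apply: smallest_sub; first exact: is_subgroup_generated.
move=> g [/GH Hg|Xg]; apply: sub_gen_smallest; [by left|by right].
Qed.

Theorem theorem3p2 (CH : continuum_hypothesis) :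
  exists I : set LF,
    [/\ lattice_ideal I,
        I `<=` ~` SF_IF &
        forall delta : LF -> 'I_2, Sigma11_Pi11_coloring delta ->
          exists2 G : LF, I G &
            exists i : 'I_2, forall G' : LF,
              (G <= G')%O -> ~ SF_IF G' -> delta G' = i].
Proof.
have [F [uF Fchain FT]] := ramsey_tower CH.
exists [set G : LF | exists x n, (G <= level_group (tail (F x) n))%O]; split.
- split.
  + by exists (level_group (tail (F set0) 0)), set0, 0.
  + by move=> G H GH [x [n Hx]]; exists x, n; apply: le_trans Hx.
  move=> G H [x [m Gx]] [y [n Hy]].
  wlog [k xy] : G H x y m n Gx Hy / almost_sub (F x) (F y).
    move=> wl; have [xy|yx] := Fchain x y; first exact: wl Gx Hy xy.
    by rewrite joinC; apply: wl Hy Gx yx.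
  (* Past [k] the set [F x] lies in [F y], so this tail is contained in both given tails. *)
  exists x, (maxn (maxn m n) k); rewrite leUx.
  apply/andP; split.
    apply: le_trans Gx _; apply: level_groupS.
    by move=> i [Fi /= ik]; split=> //=; lia.
  apply: le_trans Hy _; apply: level_groupS.
  by move=> i [Fi /= ik]; split; [apply: xy; split=> //=; lia|move=> /=; lia].
- move=> G [x [n Gx]] /(le_SF_IF Gx); apply: level_group_not_IF.
  exact: unbounded_tail.
(* One color class is enough: off it, the coloring takes the other of its two values. *)
move=> delta /(_ ord0) colored.
have [x [i xi]] : exists x (i : 'I_2), forall L, unbounded L -> L `<=` F x ->
    delta (level_group L) = i.
  have nz (j : 'I_2) : j <> ord0 -> j = ord_max.
    by case: j => -[|[|//]] ? j0; [case: j0|]; apply: val_inj.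
  case: colored => /analytic_tree_proj[T TE]; have [x [xT|xT]] := FT T.
  - by exists x, ord0 => L uL Lx; apply/TE; apply: xT.
  - by exists x, ord_max => L uL Lx; apply: nz => /TE; apply: xT.
  - by exists x, ord_max => L uL Lx; apply: nz; apply/TE; apply: xT.
  - exists x, ord0 => L uL Lx; apply: contrapT => dL.
    by apply: (xT L uL Lx); apply/TE.
exists (level_group (tail (F x) 0)); first by exists x, 0.
exists i => G' FG' nIF.
have [M [uM MF ->]] := overgroups_level_group (unbounded_tail 0 (uF x)) FG' nIF.
by apply: xi => //; apply: subset_trans MF (@sub_tail _ _).
Qed.
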